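(* Let $R$ be a nonzero polynomial and $q$ a polynomial without constant term, with complex coefficients, and put $d=\deg R$, $l=\deg q$. Let $H=-x\nabla$, $G=R(H)\Delta$ and $P_n^q(x)=e^{q(G)}\psi(x,n)$, $n\ge0$, where $\psi(x,n)=(-1)^n(-x)_n=x(x-1)\cdots(x-n+1)$. Then the polynomials $P_n^q(x)$ have the following properties: (i) They are eigenfunctions of the difference operator $$L:=q'(G)G-x\nabla.$$ (ii) They satisfy a recurrence relation of the form $$xP^q_n(x)=P^q_{n+1}(x)+\sum_{j=0}^{m}\gamma_j(n)P^q_{n-j}(x),$$ where $m=l$ for $d=0$ and $m=ld+l-1$ for $d>0$. (iii) They possess the Hahn property, i.e. the polynomial system $$Q_n(x)=\frac{\Delta P^q_{n+1}(x)}{n+1},\qquad n=0,1,\dots,$$ corresponds to $q(\hat G)$ with the new operator $\hat G=R(H+1)\Delta$, that is, $Q_n(x)=e^{q(\hat G)}\psi(x,n)$.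
   Context: All operators act on $\mathbb{C}[x]$: $\Delta f(x)=f(x+1)-f(x)$, $\nabla f(x)=f(x-1)-f(x)$. For an operator $A$ on $\mathbb{C}[x]$ lowering the degree of every polynomial, $e^{A}f=\sum_{j\ge0}\frac{A^jf}{j!}$, a finite sum for each $f$. Pochhammer symbol: $(a)_0=1$, $(a)_j=a(a+1)\cdots(a+j-1)$. In (ii), the $\gamma_j(n)$ are coefficients depending on $n$ and not on $x$, and terms with negative index $n-j$ are absent. *)

(* Defs.v *)
(* The field F is meant to be K[i], the complex numbers over K : realType. *)
From HB Require Import structures.
From mathcomp Require Import all_boot all_order all_algebra.
From mathcomp Require Import reals complex.
Set Implicit Arguments.
Unset Strict Implicit.
Unset Printing Implicit Defensive.
Import Order.TTheory GRing.Theory Num.Theory.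
Local Open Scope ring_scope.

Definition fwd (F : numFieldType) (f : {poly F}) : {poly F} :=
  f \Po ('X + 1) - f.

(* Note the sign: f(x-1) - f(x), not f(x) - f(x-1). *)
Definition bwd (F : numFieldType) (f : {poly F}) : {poly F} :=
  f \Po ('X - 1) - f.

(* p(A) for a polynomial p and an operator A on F[x]. *)
Definition op_poly (F : numFieldType) (p : {poly F})
    (A : {poly F} -> {poly F}) (f : {poly F}) : {poly F} :=
  \sum_(i < size p) p`_i *: iter i A f.

Definition lowers_degree (F : numFieldType) (A : {poly F} -> {poly F}) : Prop :=
  forall f : {poly F}, (size (A f) <= (size f).-1)%N.

(* e^A for a degree-lowering A: A^j f = 0 as soon as j >= size f, so the
   exponential series may be cut there; see op_exp_widen. *)
Definition op_exp (F : numFieldType) (A : {poly F} -> {poly F})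
    (f : {poly F}) : {poly F} :=
  \sum_(j < size f) (j`!%:R)^-1 *: iter j A f.

Lemma iter_lowers_degree (F : numFieldType) (A : {poly F} -> {poly F})
    (hA : lowers_degree A) (j : nat) (f : {poly F}) :
  (size (iter j A f) <= size f - j)%N.
Proof.
elim: j => [|j IHj]; first by rewrite subn0.
rewrite iterS subnS; apply: leq_trans (hA _) _.
by rewrite -!subn1 leq_sub2r.
Qed.

Lemma op_exp_widen (F : numFieldType) (A : {poly F} -> {poly F})
    (hA : lowers_degree A) (f : {poly F}) (N : nat) :
  (size f <= N)%N -> op_exp A f = \sum_(j < N) (j`!%:R)^-1 *: iter j A f.
Proof.
move=> le_fN; rewrite /op_exp.
rewrite -!(big_mkord xpredT (fun j => (j`!%:R)^-1 *: iter j A f)).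
rewrite [RHS](@big_cat_nat _ _ _ (size f)) //= -[LHS]addr0; congr (_ + _).
rewrite big_nat big1 // => j /andP[le_fj _].
have := iter_lowers_degree hA j f.
by rewrite (eqP le_fj) leqn0 size_poly_eq0 => /eqP->; rewrite scaler0.
Qed.

Definition pochhammer (A : comNzRingType) (a : A) (j : nat) : A :=
  \prod_(i < j) (a + i%:R).

Definition psi (F : numFieldType) (n : nat) : {poly F} :=
  (-1) ^+ n * pochhammer (- 'X) n.

Lemma psi_prod (F : numFieldType) (n : nat) :
  psi F n = \prod_(i < n) ('X - i%:R).
Proof.
rewrite /psi /pochhammer -[n in _ ^+ n]card_ord -prodrN.
by apply: eq_bigr => i _; rewrite opprD opprK.
Qed.

Definition Hop (F : numFieldType) (f : {poly F}) : {poly F} := - 'X * bwd f.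

Definition Gop (F : numFieldType) (R : {poly F}) (f : {poly F}) : {poly F} :=
  op_poly R (@Hop F) (fwd f).

(* R(H + 1) Delta *)
Definition Ghat (F : numFieldType) (R : {poly F}) (f : {poly F}) : {poly F} :=
  op_poly R (fun g => Hop g + g) (fwd f).

Definition Pq (F : numFieldType) (R q : {poly F}) (n : nat) : {poly F} :=
  op_exp (op_poly q (Gop R)) (psi F n).

Definition Lop (F : numFieldType) (R q : {poly F}) (f : {poly F}) : {poly F} :=
  op_poly q^`() (Gop R) (Gop R f) - 'X * bwd f.

Definition Qn (F : numFieldType) (R q : {poly F}) (n : nat) : {poly F} :=
  n.+1%:R^-1 *: fwd (Pq R q n.+1).

Definition eigenfunction (F : numFieldType) (A : {poly F} -> {poly F})
    (f : {poly F}) : Prop :=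
  f != 0 /\ exists lambda : F, A f = lambda *: f.

Definition deg (F : numFieldType) (p : {poly F}) : nat := (size p).-1.

(* For q = 0 we have deg q = 0, and the truncated l * d + l - 1 is 0. *)
Definition rec_order (d l : nat) : nat :=
  if d == 0%N then l else (l * d + l - 1)%N.

(* The remaining lemmas show that q(G) and q(Ghat) lower degrees when q has no
   constant term, so that op_exp is the exponential series for them. *)
Lemma size_scale_le (F : numFieldType) (a : F) (p : {poly F}) (k : nat) :
  (size p <= k)%N -> (size (a *: p) <= k)%N.
Proof. exact: leq_trans (size_scale_leq _ _). Qed.

Lemma size_op_poly (F : numFieldType) (p : {poly F})
    (A : {poly F} -> {poly F}) (f : {poly F}) (k : nat) :
  (forall g : {poly F}, (size (A g) <= size g)%N) ->
  (size f <= k)%N -> (size (op_poly p A f) <= k)%N.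
Proof.
move=> hA hf; apply: leq_trans (size_sum _ _ _) _.
apply/bigmax_leqP => i _; apply: size_scale_le.
by elim: {i}(nat_of_ord i) => //= i IHi; apply: leq_trans (hA _) _.
Qed.

Lemma size_shift_sub (F : numFieldType) (c : F) (f : {poly F}) :
  (size (f \Po ('X + c%:P) - f)%R <= (size f).-1)%N.
Proof.
have [->|f0] := eqVneq f 0; first by rewrite comp_poly0 subrr size_poly0.
have sf : (0 < size f)%N by rewrite size_poly_gt0.
have s2 : size (f \Po ('X + c%:P)) = size f.
  by rewrite size_comp_poly2 // size_XaddC.
apply/leq_sizeP => j; rewrite leq_eqVlt => /orP[/eqP <-|hj].
  have := @lead_coef_comp F f ('X + c%:P); rewrite size_XaddC => /(_ isT).
  rewrite lead_coefXaddC expr1n mulr1 !lead_coefE s2 coefB => ->.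
  by rewrite subrr.
rewrite coefB; have hj' : (size f <= j)%N by rewrite -(prednK sf).
by rewrite !nth_default ?subrr // s2.
Qed.

Lemma fwd_lowers (F : numFieldType) : lowers_degree (@fwd F).
Proof. by move=> f; rewrite /fwd -polyC1; apply: size_shift_sub. Qed.

Lemma Hop_size (F : numFieldType) (f : {poly F}) : (size (Hop f) <= size f)%N.
Proof.
rewrite /Hop mulNr size_polyN.
have hb : (size (bwd f) <= (size f).-1)%N.
  by rewrite /bwd -polyC1 -polyCN; apply: size_shift_sub.
have [->|b0] := eqVneq (bwd f) 0; first by rewrite mulr0 size_poly0.
rewrite mulrC size_mulX //; apply: leq_ltn_trans hb _.
rewrite prednK // size_poly_gt0; apply: contraNneq b0 => ->.
by rewrite /bwd comp_poly0 subrr.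
Qed.

Lemma Gop_lowers (F : numFieldType) (R : {poly F}) : lowers_degree (Gop R).
Proof. by move=> f; apply: size_op_poly (@Hop_size F) (fwd_lowers f). Qed.

Lemma Ghat_lowers (F : numFieldType) (R : {poly F}) : lowers_degree (Ghat R).
Proof.
move=> f; apply: size_op_poly (fwd_lowers f) => g.
apply: leq_trans (size_polyD _ _) _.
by rewrite geq_max Hop_size leqnn.
Qed.

Lemma op_poly_lowers (F : numFieldType) (q : {poly F})
    (A : {poly F} -> {poly F}) :
  q`_0 = 0 -> lowers_degree A -> lowers_degree (op_poly q A).
Proof.
move=> q0 hA f; apply: leq_trans (size_sum _ _ _) _.
apply/bigmax_leqP => -[[|i] hi] _ /=; first by rewrite q0 scale0r size_poly0.
apply: size_scale_le; apply: leq_trans (iter_lowers_degree hA i.+1 f) _.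
by rewrite -subn1 leq_sub2l.
Qed.

(* Main.v *)
Require Import Defs.
From HB Require Import structures.
From mathcomp Require Import all_boot all_order all_algebra.
From mathcomp Require Import reals complex.
From mathcomp Require Import ring.
Set Implicit Arguments.
Unset Strict Implicit.
Unset Printing Implicit Defensive.
Import Order.TTheory GRing.Theory Num.Theory.
Local Open Scope ring_scope.

(** The polynomials psi_n form a basis in which every operator of the theorem
    is explicit: H psi_n = n psi_n, Delta psi_n = n psi_(n-1), hence
    G psi_n = f(n) psi_(n-1) with f(t) = t R(t - 1), and
    x psi_n = psi_(n+1) + n psi_n.  Put Q = q(G), so that P_n = e^Q psi_n.
    All three properties come from moving an operator across e^Q.

    The tool is the expansion T e^Q = sum_k e^Q C_k / k! with C_0 = T and
    C_(k+1) = [C_k, Q], valid as soon as the C_k vanish eventually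
    ([op_exp_conj]).

    (i) Since [H, G] = - G, one has [H, Q] = - q'(G) G, which commutes with Q.
    The expansion stops after two terms, H e^Q = e^Q H - q'(G) G e^Q, that is
    L e^Q = e^Q H, and P_n inherits the eigenvalue n of psi_n ([Lop_op_exp]).

    (ii) Take T = multiplication by x, and let d = deg R and l = deg q.  Write
    operators that do not raise the index as sums of terms G^j p(H) with p a
    polynomial.  As G^k p(H) = p(H + k) G^k, the commutator with q_k G^k turns
    G^j p(H) into G^(j+k) q_k (p(H - k) - p(H)): the degree of p drops by at
    least one while j grows by at most l.  Thus the weight l * deg p + j never
    increases ([weight_comm_symbol]), and the iterated commutators die out
    ([size_comm_symbol]).  Now x = S + H with S psi_n = psi_(n+1).  Since
    S G = f(H) and G S = f(H + 1), the commutator [S, Q] is a sum of terms with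
    deg p <= d and j <= l - 1, of weight at most ld + l - 1; and H has
    weight l.  Hence e^(-Q) x e^Q - S = H + sum_(k > 0) C_k / k! has weight at
    most ld + l - 1 if d, l > 0 and at most l otherwise, and the weight bounds
    the exponent j of G, that is, the number of steps down in the recurrence.

    (iii) Delta H = (H + 1) Delta gives Delta G = Ghat Delta, so that
    Delta e^(q(G)) = e^(q(Ghat)) Delta ([op_exp_intertwine]); this is applied
    to psi_(n+1). *)

(** * Linearity of the operators *)

Section Operators.
Variable F : numFieldType.
Local Notation P := {poly F}.
Implicit Types (A B Q T : {linear P -> P}) (f g p q R : P).

Lemma fwd_is_linear : linear (@fwd F).
Proof.
by move=> a f g; rewrite /fwd comp_polyD comp_polyZ scalerBr opprD addrACA.
Qed.
HB.instance Definition _ :=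
  GRing.isLinear.Build F P P _ (@fwd F) fwd_is_linear.

Lemma Hop_is_linear : linear (@Hop F).
Proof.
move=> a f g; rewrite /Hop /bwd comp_polyD comp_polyZ.
by rewrite -!mul_polyC; ring.
Qed.
HB.instance Definition _ :=
  GRing.isLinear.Build F P P _ (@Hop F) Hop_is_linear.

Lemma iter_is_linear n A : linear (iter n A).
Proof. by elim: n => // n IHn a f g; rewrite !iterS IHn linearP. Qed.
HB.instance Definition _ n A :=
  GRing.isLinear.Build F P P _ (iter n A) (iter_is_linear n A).

Lemma op_poly_is_linear p A : linear (op_poly p A).
Proof.
move=> a f g; rewrite /op_poly scaler_sumr -big_split; apply: eq_bigr => i _ /=.
by rewrite linearP scalerDr !scalerA mulrC.
Qed.
HB.instance Definition _ p A :=
  GRing.isLinear.Build F P P _ (op_poly p A) (op_poly_is_linear p A).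

Lemma Gop_is_linear R : linear (Gop R).
Proof. by move=> a f g; rewrite /Gop !linearP. Qed.
HB.instance Definition _ R :=
  GRing.isLinear.Build F P P _ (Gop R) (Gop_is_linear R).

(** * Moving an operator across an exponential *)

Definition commutator (A B : P -> P) f := A (B f) - B (A f).

Lemma commutator_is_linear A B : linear (commutator A B).
Proof.
move=> a f g; rewrite /commutator (linearP B) !(linearP A) (linearP B).
by rewrite scalerBr opprD addrACA.
Qed.
HB.instance Definition _ A B :=
  GRing.isLinear.Build F P P _ (commutator A B) (commutator_is_linear A B).

(** Up to the sign (-1)^k, the k-th power of the adjoint action of Q, applied
    to T. *)
Definition ad Q T : nat -> {linear P -> P} :=
  fix ad_rec k : {linear P -> P} :=
    if k is k'.+1 then commutator (ad_rec k') Q else T.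

(** The truncation order of [op_exp] varies with its argument; for an operator
    that lowers degrees, one order serves all the arguments involved. *)
Lemma op_exp_linear A : lowers_degree A ->
  exists E : {linear P -> P}, op_exp A =1 E.
Proof.
move=> hA; have hE : linear (op_exp A).
  move=> a f g; pose N := maxn (size (a *: f + g)) (maxn (size f) (size g)).
  rewrite !(@op_exp_widen _ _ hA _ N) ?leq_max ?leqnn ?orbT //.
  rewrite scaler_sumr -big_split; apply: eq_bigr => i _ /=.
  by rewrite linearP scalerDr !scalerA mulrC.
pose E : {linear P -> P} :=
  HB.pack (op_exp A) (GRing.isLinear.Build F P P _ _ hE).
by exists E.
Qed.

(** The binomial theorem for right multiplication by Q, which is the sum of two
    commuting operations: left multiplication by Q and commutation with Q. *)
Lemma ad_expansion Q T N f :
  T (iter N Q f)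
    = \sum_(k < N.+1) 'C(N, k)%:R *: iter (N - k) Q (ad Q T k f).
Proof.
elim: N f => [|N IHN] f.
  by rewrite big_ord_recl big_ord0 addr0 bin0 scale1r.
(* C_k Q = Q C_k + C_(k+1), the source of Pascal's rule. *)
have step (k : 'I_N.+1) : 'C(N, k)%:R *: iter (N - k) Q (ad Q T k (Q f)) =
    'C(N, k)%:R *: iter (N.+1 - k) Q (ad Q T k f)
      + 'C(N, k)%:R *: iter (N - k) Q (ad Q T k.+1 f).
  rewrite -scalerDr subSn ?leq_ord // iterSr -linearD; congr (_ *: iter _ _ _).
  by rewrite /= /commutator addrC subrK.
rewrite iterSr IHN (eq_bigr _ (fun k _ => step k)) big_split /=.
rewrite big_ord_recl [RHS]big_ord_recl /= !bin0 -addrA; congr (_ + _).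
under [RHS]eq_bigr => k _ do rewrite /bump /= add1n binS natrD scalerDl subSS.
rewrite big_split /=; congr (_ + _).
by rewrite big_ord_recr /= bin_small // scale0r addr0.
Qed.

(** Divided by N!, [ad_expansion] is a Cauchy product; summed over N it becomes
    T e^Q = sum_k e^Q C_k / k!. *)
Lemma op_exp_conj Q T K f : lowers_degree Q ->
    (forall k, (K <= k)%N -> ad Q T k f = 0) ->
  T (op_exp Q f) = \sum_(k < K) (k`!%:R)^-1 *: op_exp Q (ad Q T k f).
Proof.
move=> hQ h0.
(* Cut the outer exponential at D + K: what is left for the k-th inner one is
   D + K - k >= D terms, enough for each C_k f. *)
pose D := (\max_(k < K) size (ad Q T k f) + size f)%N.
have hD (k : 'I_K) : (size (ad Q T k f) <= D)%N.
  by apply: leq_trans (leq_addr _ _); apply: leq_bigmax.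
rewrite (@op_exp_widen _ _ hQ f (D + K)) ?linear_sum; last first.
  by rewrite /D -addnA addnCA leq_addr.
have dividedE N : (N`!%:R)^-1 *: T (iter N Q f) = \sum_(k < K | (k <= N)%N)
    (k`!%:R)^-1 *: (((N - k)`!%:R)^-1 *: iter (N - k) Q (ad Q T k f)).
  rewrite ad_expansion scaler_sumr.
  pose t k := (k`!%:R : F)^-1 *:
    (((N - k)`!%:R)^-1 *: iter (N - k) Q (ad Q T k f)).
  have fact_neq0 m : (m`!%:R : F) != 0 by rewrite pnatr_eq0 -lt0n fact_gt0.
  transitivity (\sum_(k < N.+1) t k).
    apply: eq_bigr => k _; rewrite /t !scalerA; congr (_ *: _).
    have := bin_fact (leq_ord k) => <-; rewrite !natrM.
    have hb : ('C(N, k)%:R : F) != 0.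
      by rewrite pnatr_eq0 -lt0n bin_gt0 leq_ord.
    by field; rewrite hb !fact_neq0.
  rewrite -!(big_mkord xpredT t) -(big_mkord (fun k => (k <= N)%N) t).
  rewrite (big_nat_widen _ _ (N.+1 + K)) ?leq_addr //.
  rewrite [RHS](big_nat_widen _ _ (N.+1 + K)) ?leq_addl //.
  rewrite [LHS]big_mkcond [RHS]big_mkcond; apply: eq_bigr => k _ /=.
  rewrite ltnS andbC; case: (leqP k N) => //= _; case: ltnP => // hK.
  by rewrite /t h0 // linear0 !scaler0.
under eq_bigr => N _ do rewrite linearZ /= dividedE.
rewrite (exchange_big_dep xpredT) //=; apply: eq_bigr => k _.
rewrite -scaler_sumr; congr (_ *: _).
have hkK := ltnW (ltn_ord k).
rewrite (@op_exp_widen _ _ hQ _ (D + K - k)); last first.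
  by rewrite -addnBA // (leq_trans (hD k)) ?leq_addr.
rewrite -(big_mkord (fun N => (k <= N)%N)
  (fun N => ((N - k)`!%:R)^-1 *: iter (N - k) Q (ad Q T k f))).
rewrite -(big_mkord xpredT (fun N => (N`!%:R)^-1 *: iter N Q (ad Q T k f))).
have le_kDK : (k <= D + K)%N by apply: leq_trans hkK (leq_addl _ _).
rewrite (big_cat_nat (n := k)) //= [X in X + _]big_nat_cond big_pred0 ?add0r.
  rewrite -{1}[nat_of_ord k]add0n big_addn big_mkord big_mkord.
  by apply: eq_big => N; rewrite ?leq_addl // addnK.
by move=> N; case: ltnP => // ; rewrite andbF.
Qed.

Lemma iter_intertwine (A A' B : P -> P) :
  (forall f, B (A f) = A' (B f)) ->
  forall n f, B (iter n A f) = iter n A' (B f).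
Proof. by move=> h; elim=> // n IHn f; rewrite !iterS h IHn. Qed.

Lemma op_poly_intertwine p (A A' : P -> P) B :
  (forall f, B (A f) = A' (B f)) ->
  forall f, B (op_poly p A f) = op_poly p A' (B f).
Proof.
move=> h f; rewrite linear_sum; apply: eq_bigr => i _.
by rewrite linearZ /= (iter_intertwine h).
Qed.

Lemma op_exp_intertwine (A A' : P -> P) B :
    lowers_degree A -> lowers_degree A' ->
    (forall f, B (A f) = A' (B f)) ->
  forall f, B (op_exp A f) = op_exp A' (B f).
Proof.
move=> hA hA' h f.
rewrite (op_exp_widen hA (leq_maxl _ (size (B f)))).
rewrite (op_exp_widen hA' (leq_maxr (size f) _)).
rewrite linear_sum; apply: eq_bigr => i _.
by rewrite linearZ /= (iter_intertwine h).
Qed.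

Lemma op_poly_widen p (A : P -> P) f N : (size p <= N)%N ->
  op_poly p A f = \sum_(i < N) p`_i *: iter i A f.
Proof.
move=> h; rewrite /op_poly (big_ord_widen _ (fun i => p`_i *: iter i A f) h).
rewrite big_mkcond; apply: eq_bigr => i _ /=; case: ltnP => // hi.
by rewrite nth_default ?scale0r.
Qed.

Lemma op_poly_no_const q (A : P -> P) f : q`_0 = 0 ->
  op_poly q A f = \sum_(k < (size q).-1) q`_k.+1 *: iter k.+1 A f.
Proof.
move=> q0; rewrite /op_poly; case: (size q) => [|m]; first by rewrite !big_ord0.
by rewrite big_ord_recl q0 scale0r add0r.
Qed.

Lemma op_poly_eigen p A f a :
  A f = a *: f -> op_poly p A f = p.[a] *: f.
Proof.
move=> h; rewrite /op_poly horner_coef scaler_suml; apply: eq_bigr => i _.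
rewrite -scalerA; congr (_ *: _).
elim: (nat_of_ord i) => [|k IHk] /=; first by rewrite scale1r.
by rewrite IHk linearZ /= h scalerA exprSr.
Qed.

(** e^A f = f + terms of smaller degree. *)
Lemma op_exp_neq0 A f : lowers_degree A -> f != 0 -> op_exp A f != 0.
Proof.
move=> hA f0; rewrite /op_exp.
have := f0; rewrite -size_poly_gt0; case es: (size f) => [//|m] _.
rewrite big_ord_recl fact0 invr1 scale1r /=.
apply: contraTneq (ltnSn m) => /eqP; rewrite addr_eq0 => /eqP ef.
rewrite -leqNgt -es ef size_polyN; apply: leq_trans (size_sum _ _ _) _.
apply/bigmax_leqP => i _; apply: size_scale_le.
apply: leq_trans (hA _) _; rewrite -subn1 leq_subLR add1n -es.
by apply: leq_trans (iter_lowers_degree hA i f) _; rewrite leq_subr.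
Qed.

(** * The basis psi *)

Lemma psiS n : psi F n.+1 = psi F n * ('X - n%:R).
Proof. by rewrite !psi_prod big_ord_recr. Qed.

Lemma psiS_shift n : psi F n.+1 = 'X * (psi F n \Po ('X - 1)).
Proof.
rewrite !psi_prod big_ord_recl subr0 rmorph_prod; congr (_ * _).
apply: eq_bigr => i _ /=; rewrite rmorphB /= comp_polyX rmorph_nat.
by rewrite /bump /= natrD opprD addrA.
Qed.

Lemma size_psi n : size (psi F n) = n.+1.
Proof.
rewrite psi_prod (eq_bigr (fun i : 'I_n => 'X - (i%:R)%:P)) => [|i _].
  by rewrite size_prod_XsubC /index_enum -enumT size_enum_ord.
by rewrite polyC_natr.
Qed.

Lemma psi_neq0 n : psi F n != 0.
Proof. by rewrite -size_poly_eq0 size_psi. Qed.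

(** The psi_n span: psi_n has degree n, so the leading term of any polynomial
    can be cancelled by a multiple of some psi_n. *)
Lemma eq_on_psi A B : (forall n, A (psi F n) = B (psi F n)) -> A =1 B.
Proof.
move=> h f; have [m] := ubnP (size f).
elim: m f => // m IHm f; rewrite ltnS => hf.
have [->|f0] := eqVneq f 0; first by rewrite !linear0.
pose n := (size f).-1; have sf : size f = n.+1.
  by rewrite /n prednK // size_poly_gt0.
have lp0 : lead_coef (psi F n) != 0 by rewrite lead_coef_eq0 psi_neq0.
pose c := lead_coef f / lead_coef (psi F n).
suff hs : (size (f - c *: psi F n)%R < m)%N.
  have -> : f = (f - c *: psi F n) + c *: psi F n by rewrite subrK.
  by rewrite [LHS]linearD [RHS]linearD IHm // !linearZ /= h.
apply: leq_trans hf; rewrite sf ltnS.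
apply/leq_sizeP => j; rewrite leq_eqVlt => /orP[/eqP <-|hj]; last first.
  by rewrite coefB coefZ !nth_default ?mulr0 ?subr0 // ?size_psi // sf.
have e1 : f`_n = lead_coef f by rewrite lead_coefE sf.
have e2 : (psi F n)`_n = lead_coef (psi F n) by rewrite lead_coefE size_psi.
by rewrite coefB coefZ e1 e2 /c divfK // subrr.
Qed.

Lemma Hop_psi n : Hop (psi F n) = n%:R *: psi F n.
Proof.
rewrite /Hop /bwd mulNr mulrBr -psiS_shift psiS.
rewrite scaler_nat -mulr_natr; ring.
Qed.

Lemma fwd_psi n : fwd (psi F n) = n%:R *: psi F n.-1.
Proof.
case: n => [|n].
  by rewrite scale0r psi_prod big_ord0 /fwd comp_polyC subrr.
rewrite /fwd {1}psiS_shift comp_polyM comp_polyX -comp_polyA.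
rewrite comp_polyB comp_polyX comp_polyC addrK comp_polyXr /=.
rewrite psiS scaler_nat -mulr_natr; ring.
Qed.

Lemma mulX_psi n : 'X * psi F n = psi F n.+1 + n%:R *: psi F n.
Proof. by rewrite psiS scaler_nat -mulr_natr; ring. Qed.


(** Delta lowers the index by one, hence shifts the eigenvalues of H. *)
Lemma fwd_Hop f : fwd (Hop f) = Hop (fwd f) + fwd f.
Proof.
apply: (@eq_on_psi (@fwd F \o @Hop F) ((@Hop F \o @fwd F) \+ @fwd F)) => n /=.
rewrite Hop_psi linearZ /= !fwd_psi [Hop (_ *: _)]linearZ /= Hop_psi.
case: n => [|n] /=; first by rewrite !scale0r addr0.
by rewrite -scalerDr -[X in _ = _ *: (_ + X)]scale1r -scalerDl natr1.
Qed.

(** * Symbols of operators *)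

Definition Gcoef R : P := 'X * (R \Po ('X - 1)).

Lemma Gcoef0 R : (Gcoef R).[0] = 0.
Proof. by rewrite hornerM hornerX mul0r. Qed.

Lemma size_Gcoef R : R != 0 -> size (Gcoef R) = (size R).+1.
Proof.
move=> hR; have e : size (R \Po ('X - 1)) = size R.
  by rewrite size_comp_poly2 // -polyC1 size_XsubC.
by rewrite /Gcoef mulrC size_mulX ?e // -size_poly_eq0 e size_poly_eq0.
Qed.

Lemma Gop_psi R n : Gop R (psi F n) = (Gcoef R).[n%:R] *: psi F n.-1.
Proof.
rewrite /Gop fwd_psi linearZ /= (op_poly_eigen _ (Hop_psi _)) scalerA.
case: n => [|n]; first by rewrite Gcoef0 mul0r.
by rewrite hornerM hornerX horner_comp !hornerE -natr1 addrK.
Qed.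

(** When j > n the truncated index n - j is harmless: the factor i = n of the
    product is the value of [Gcoef] at 0, which is 0. *)
Lemma iter_Gop_psi R j n : iter j (Gop R) (psi F n)
  = (\prod_(i < j) (Gcoef R).[(n - i)%:R]) *: psi F (n - j).
Proof.
elim: j => [|j IHj]; first by rewrite big_ord0 scale1r subn0.
by rewrite iterS IHj linearZ /= Gop_psi scalerA big_ord_recr /= subnS.
Qed.

Lemma iter_Gop_psi_eq0 R j n : (n < j)%N -> iter j (Gop R) (psi F n) = 0.
Proof.
move=> h; apply/eqP; rewrite -size_poly_leq0.
apply: leq_trans (iter_lowers_degree (@Gop_lowers F R) _ _) _.
by rewrite size_psi leqn0 subn_eq0.
Qed.

(** The pairs (j, p) of the list stand for the terms of T = sum G^j p(H).  A
    list is used rather than a family indexed by j, so that sums and commutators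
    of operators become concatenations and products of lists, with no
    regrouping. *)
Definition has_symbol R (T : P -> P) (s : seq (nat * P)) :=
  forall n, T (psi F n)
    = \sum_(u <- s) u.2.[n%:R] *: iter u.1 (Gop R) (psi F n).

(** The zero polynomial satisfies every bound: its degree is 0 by convention,
    so that a difference that vanishes need not have a smaller [deg]. *)
Definition weight_le l M (s : seq (nat * P)) :=
  all (fun u => (u.2 == 0) || (l * deg u.2 + u.1 <= M)%N) s.

(** G^k psi_n is a multiple of psi_(n-k), on which H has eigenvalue n - k; both
    sides vanish when k > n. *)
Lemma has_symbol_iter R T s k n : has_symbol R T s ->
  T (iter k (Gop R) (psi F n)) = \sum_(u <- s)
    (u.2 \Po ('X - k%:R)).[n%:R] *: iter (u.1 + k) (Gop R) (psi F n).
Proof.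
move=> hT; case: (leqP k n) => [kn|nk]; last first.
  rewrite iter_Gop_psi_eq0 // linear0 big1 // => u _.
  by rewrite iter_Gop_psi_eq0 ?scaler0 // ltn_addl.
rewrite {1}iter_Gop_psi linearZ /= hT scaler_sumr; apply: eq_bigr => u _.
rewrite iterD (iter_Gop_psi R k) [in RHS]linearZ /= !scalerA mulrC.
by rewrite horner_comp -polyC_natr hornerXsubC natrB.
Qed.

(** The symbol of [T, q(G)], by G^j p(H) G^k = G^(j+k) p(H - k). *)
Definition comm_symbol q (s : seq (nat * P)) :=
  [seq ((u.1 + k)%N, q`_k *: (u.2 \Po ('X - k%:R) - u.2))
     | k <- index_iota 0 (size q), u <- s].

Lemma has_symbol_commutator R q T s : has_symbol R T s ->
  has_symbol R (commutator T (op_poly q (Gop R))) (comm_symbol q s).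
Proof.
move=> hT n; rewrite /commutator big_allpairs_dep big_mkord /op_poly hT.
rewrite linear_sum -sumrB /=; apply: eq_bigr => k _.
rewrite linearZ /= -scalerBr (has_symbol_iter _ _ hT) linear_sum.
rewrite -sumrB scaler_sumr.
apply: eq_bigr => u _; rewrite linearZ /= -iterD addnC -scalerBl scalerA.
by rewrite hornerZ !hornerE.
Qed.

(** p(t - k) - p(t) has smaller degree than p, so that iterating commutators
    kills every symbol. *)
Lemma size_comm_symbol q s a : all (fun u : nat * P => (size u.2 <= a)%N) s ->
  all (fun u : nat * P => (size u.2 <= a.-1)%N) (comm_symbol q s).
Proof.
move=> /allP hs; apply/allP => _ /allpairsPdep[k [u [_ hu ->]]] /=.
apply: size_scale_le; rewrite -polyC_natr -polyCN.
apply: leq_trans (size_shift_sub _ _) _.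
by rewrite -!subn1 leq_sub2r // hs.
Qed.

(** The exponent of G grows by some k <= deg q, and the degree drops by at least
    one, which is worth deg q in the weight. *)
Lemma weight_comm_symbol q s M : weight_le (deg q) M s ->
  weight_le (deg q) M (comm_symbol q s).
Proof.
move=> /allP hs; apply/allP => _ /allpairsPdep[k [u [hk hu ->]]] /=.
set p := _ *: _; have [//|p0 /=] := eqVneq p 0.
have sp : (size p <= (size u.2).-1)%N.
  apply: size_scale_le; rewrite -polyC_natr -polyCN.
  exact: size_shift_sub.
have p_gt0 : (0 < size p)%N by rewrite size_poly_gt0.
have u0 : u.2 != 0.
  by rewrite -size_poly_gt0; case: size sp p_gt0 => //; case: size.
have := hs _ hu; rewrite (negPf u0) /=; apply: leq_trans.
have du : ((deg p).+1 <= deg u.2)%N by rewrite /deg prednK.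
have kl : (k <= deg q)%N.
  by move: hk; rewrite mem_index_iota /deg; case: (size q).
rewrite addnA addnAC leq_add2r.
by apply: leq_trans (leq_mul (leqnn _) du); rewrite mulnS addnC leq_add2r.
Qed.

(** * Multiplication by x and its iterated commutators *)

Definition mulX f := 'X * f.

Lemma mulX_is_linear : linear mulX.
Proof. by move=> a f g; rewrite /mulX mulrDr scalerAr. Qed.
HB.instance Definition _ :=
  GRing.isLinear.Build F P P _ mulX mulX_is_linear.

(** The part of x that raises the index of psi_n. *)
Definition raise f := mulX f - Hop f.

Lemma raise_is_linear : linear raise.
Proof.
move=> a f g; rewrite /raise linearP [Hop _]linearP.
by rewrite scalerBr opprD addrACA.
Qed.
HB.instance Definition _ :=
  GRing.isLinear.Build F P P _ raise raise_is_linear.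

Lemma raise_psi n : raise (psi F n) = psi F n.+1.
Proof. by rewrite /raise Hop_psi /mulX mulX_psi addrK. Qed.

(** The symbol of [raise, q(G)].  A factor G is absorbed: for k > 0,
    raise G^k = G^(k-1) f(H - k + 1) and G^k raise = G^(k-1) f(H + 1), where f
    is [Gcoef].  The entry k of the list comes from the term q_(k+1) G^(k+1). *)
Definition raise_symbol R q : seq (nat * P) :=
  [seq (k, q`_k.+1 *: ((Gcoef R \Po ('X - k.+1%:R) - Gcoef R) \Po ('X + 1)))
     | k <- index_iota 0 (size q).-1].

Lemma has_symbol_raise R q : q`_0 = 0 ->
  has_symbol R (commutator raise (op_poly q (Gop R))) (raise_symbol R q).
Proof.
move=> q0 n; rewrite /commutator !op_poly_no_const // linear_sum -sumrB.
rewrite big_map big_mkord; apply: eq_bigr => k _.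
(* raise G = f(H), including on psi_0 because f(0) = 0. *)
have hS : has_symbol R (raise \o Gop R) [:: (0%N, Gcoef R)].
  move=> m; rewrite big_seq1 /= Gop_psi linearZ /= raise_psi.
  by case: m => // ; rewrite Gcoef0 !scale0r.
have e1 := has_symbol_iter k n hS.
have e2 : Gop R (iter k (Gop R) (psi F n.+1))
    = (Gcoef R).[n.+1%:R] *: iter k (Gop R) (psi F n).
  by rewrite -iterS iterSr Gop_psi linearZ.
rewrite linearZ /= -scalerBr raise_psi e2; move: e1; rewrite big_seq1 /= => ->.
rewrite -scalerBl scalerA hornerZ; congr (_ * _ *: _).
generalize (Gcoef R) => c.
rewrite -!polyC_natr !horner_comp !hornerD !hornerN !hornerC horner_comp.
by rewrite !hornerE -![_.+1%:R]natr1 [in RHS]opprD addrACA subrr addr0.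
Qed.

Lemma size_raise_symbol R q : R != 0 ->
  all (fun u : nat * P => (size u.2 <= size R)%N) (raise_symbol R q).
Proof.
move=> hR; apply/allP => _ /mapP[k _ ->] /=; apply: size_scale_le.
rewrite size_comp_poly2 -?polyC1 ?size_XaddC // -polyC_natr -polyCN.
by apply: leq_trans (size_shift_sub _ _) _; rewrite size_Gcoef.
Qed.

Lemma weight_raise_symbol R q : R != 0 ->
  weight_le (deg q) (rec_order (deg R) (deg q)) (raise_symbol R q).
Proof.
move=> hR; have /allP sR := size_raise_symbol q hR.
apply/allP => u hu; have := sR u hu; case/mapP: hu => k hk ->.
set p := _ *: _; rewrite /= => sp; apply/orP; right.
have dp : (deg p <= deg R)%N by rewrite /deg -!subn1 leq_sub2r.
have kq : (k < deg q)%N by move: hk; rewrite mem_index_iota.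
rewrite /rec_order; case: eqP dp => [->|_ dp].
  by rewrite leqn0 => /eqP ->; rewrite muln0 ltnW.
have l_gt0 : (0 < deg q)%N by apply: leq_ltn_trans kq.
by rewrite -addnBA // leq_add ?leq_mul // -ltnS subn1 prednK.
Qed.

Lemma has_symbol_Hop R : has_symbol R (@Hop F) [:: (0%N, 'X)].
Proof. by move=> n; rewrite big_seq1 /= hornerX Hop_psi. Qed.

(** H has weight l = deg q, and when d > 0 and l > 0 the order ld + l - 1 is at
    least l. *)
Lemma weight_Hop R q :
  weight_le (deg q) (rec_order (deg R) (deg q)) [:: (0%N, 'X : P)].
Proof.
rewrite /weight_le /= /deg size_polyX muln1 addn0 andbT; apply/orP; right.
rewrite /rec_order; case: eqP => // /eqP; rewrite -lt0n => d0.
case: (size q).-1 => // l; rewrite -addnBA // subn1 /=.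
by apply: leq_trans (leq_addr _ _); rewrite leq_pmulr.
Qed.

(** The bound on the degrees in H shrinks with k, which makes the commutators
    vanish, while the bound on the weight is the order of the recurrence for
    all k. *)
Lemma has_symbol_ad R q k : R != 0 -> q`_0 = 0 ->
  exists s, [/\ has_symbol R (ad (op_poly q (Gop R)) mulX k.+1) s,
    all (fun u : nat * P => (size u.2 <= size R - k)%N) s &
    weight_le (deg q) (rec_order (deg R) (deg q)) s].
Proof.
move=> hR q0; elim: k => [|k [s [hs zs ws]]]; last first.
  exists (comm_symbol q s); split; last exact: weight_comm_symbol.
    exact: has_symbol_commutator.
  by rewrite subnS; apply: size_comm_symbol.
exists (raise_symbol R q ++ comm_symbol q [:: (0%N, 'X)]); split.
- move=> n; rewrite big_cat /= -has_symbol_raise //.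
  rewrite -(has_symbol_commutator q (@has_symbol_Hop R)).
  have mulXE f : mulX f = raise f + Hop f by rewrite /raise subrK.
  by rewrite /= /commutator !mulXE linearD opprD addrACA.
- rewrite all_cat subn0 size_raise_symbol //=.
  have := @size_comm_symbol q [:: (0%N, 'X)] 2.
  rewrite /= size_polyX => /(_ isT).
  apply: sub_all => u /leq_trans; apply; by rewrite size_poly_gt0.
rewrite /weight_le all_cat; apply/andP; split; first exact: weight_raise_symbol.
exact/weight_comm_symbol/weight_Hop.
Qed.

Lemma ad_mulX_eq0 R q k n : R != 0 -> q`_0 = 0 -> (size R < k)%N ->
  ad (op_poly q (Gop R)) mulX k (psi F n) = 0.
Proof.
case: k => // k hR q0; rewrite ltnS -subn_eq0 => /eqP hk.
have [s [hs /allP sz _]] := has_symbol_ad k hR q0.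
rewrite hs big_seq big1 // => u /sz; rewrite hk size_poly_leq0 => /eqP ->.
by rewrite horner0 scale0r.
Qed.

(** The weight dominates the exponent of G, that is, the drop of the index. *)
Lemma weight_le_recurrence R (T : P -> P) s l M :
    has_symbol R T s -> weight_le l M s ->
  exists gamma : nat -> nat -> F, forall n,
    T (psi F n) = \sum_(j < M.+1 | (j <= n)%N) gamma j n *: psi F (n - j).
Proof.
move=> hT /allP ws.
exists (fun j n => \sum_(u <- s | u.1 == j)
  u.2.[n%:R] * \prod_(i < j) (Gcoef R).[(n - i)%:R]) => n.
rewrite hT; under [RHS]eq_bigr => j _ do rewrite scaler_suml.
rewrite (exchange_big_dep xpredT) //= big_seq [RHS]big_seq.
apply: eq_bigr => u hu.
have := ws u hu; have [->|u0 /= hM] := eqVneq u.2 0.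
  by rewrite horner0 scale0r big1 // => j _; rewrite mul0r scale0r.
have uM : (u.1 < M.+1)%N by rewrite ltnS (leq_trans (leq_addl _ _) hM).
case: (leqP u.1 n) => [un|nu].
  rewrite (big_pred1 (Ordinal uM)) => [|j].
    by rewrite iter_Gop_psi scalerA.
  by rewrite /= -val_eqE /= eq_sym; case: eqP => [->|]; rewrite ?un ?andbF.
rewrite iter_Gop_psi_eq0 // scaler0 big_pred0 // => j.
by case: eqP => [<-|]; rewrite ?andbF // leqNgt nu.
Qed.

(** * The three properties *)

Lemma Pq_recurrence R q : R != 0 -> q`_0 = 0 ->
  exists gamma : nat -> nat -> F, forall n,
    'X * Pq R q n = Pq R q n.+1
      + \sum_(j < (rec_order (deg R) (deg q)).+1 | (j <= n)%N)
          gamma j n *: Pq R q (n - j).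
Proof.
move=> hR q0; set M := rec_order _ _; set Q := op_poly q (Gop R).
have hQ : lowers_degree Q := op_poly_lowers q0 (@Gop_lowers F R).
(* A symbol of e^(-Q) x e^Q - raise, the sum of H and of the C_k / k!, k > 0. *)
have [s hs ws] : exists2 s, forall n, Hop (psi F n)
      + \sum_(k < size R) (k.+1`!%:R)^-1 *: ad Q mulX k.+1 (psi F n)
        = \sum_(u <- s) u.2.[n%:R] *: iter u.1 (Gop R) (psi F n)
    & weight_le (deg q) M s.
  elim: (size R) => [|m [s hs ws]].
    exists [:: (0%N, 'X)]; last exact: weight_Hop.
    by move=> n; rewrite big_ord0 addr0; apply: has_symbol_Hop.
  have [t [ht _ wt]] := has_symbol_ad m hR q0.
  exists (s ++ [seq (u.1, (m.+1`!%:R)^-1 *: u.2) | u <- t]) => [n|].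
    rewrite big_ord_recr addrA hs big_cat big_map ht scaler_sumr /=.
    by congr (_ + _); apply: eq_bigr => u _; rewrite hornerZ scalerA.
  rewrite /weight_le all_cat; apply/andP; split; first exact: ws.
  rewrite all_map; apply: sub_all wt => u /=.
  rewrite scaler_eq0 /deg size_scale.
    by case/orP => ->; rewrite orbT.
  by rewrite invr_eq0 pnatr_eq0 -lt0n fact_gt0.
have [E opE] := op_exp_linear hQ.
pose Y f := Hop f + \sum_(k < size R) (k.+1`!%:R)^-1 *: ad Q mulX k.+1 f.
have [gamma hgamma] := @weight_le_recurrence R Y s _ _ hs ws.
exists gamma => n; rewrite -/(mulX _).
rewrite (@op_exp_conj _ _ (size R).+1) //; last first.
  by move=> k hk; apply: ad_mulX_eq0.
transitivity (E (psi F n.+1 + Y (psi F n))).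
  rewrite big_ord_recl fact0 invr1 scale1r /= /Y addrA -[psi F n.+1]raise_psi.
  rewrite /raise subrK linearD linear_sum opE; congr (_ + _).
  by apply: eq_bigr => k _; rewrite opE linearZ.
rewrite hgamma linearD linear_sum /Pq -/Q opE; congr (_ + _).
by apply: eq_bigr => j _; rewrite linearZ /= opE.
Qed.

(** G^k psi_n has H-eigenvalue n - k, so that [H, G^k] = - k G^k. *)
Lemma commutator_Hop R q f :
  commutator (@Hop F) (op_poly q (Gop R)) f
    = - op_poly q^`() (Gop R) (Gop R f).
Proof.
apply: (@eq_on_psi (commutator (@Hop F) (op_poly q (Gop R)))
  (\- (op_poly q^`() (Gop R) \o Gop R))) => n /=.
rewrite (has_symbol_commutator q (@has_symbol_Hop R)).
rewrite big_allpairs_dep big_mkord.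
rewrite (@op_poly_widen _ _ _ (size q).-1) ?size_poly //.
case: (size q) => [|m]; first by rewrite !big_ord0 oppr0.
rewrite big_ord_recl big_seq1 /= subr0 comp_polyXr subrr scaler0 horner0.
rewrite scale0r add0r -sumrN; apply: eq_bigr => k _.
rewrite big_seq1 /= comp_polyX addrAC subrr add0r coef_deriv add0n -iterSr.
by rewrite scalerN hornerN scaleNr hornerZ -polyC_natr hornerC mulr_natr.
Qed.

(** [H, Q] = - q'(G) G commutes with Q, hence H e^Q = e^Q H - q'(G) G e^Q. *)
Lemma Lop_op_exp R q f : q`_0 = 0 ->
  Lop R q (op_exp (op_poly q (Gop R)) f)
    = op_exp (op_poly q (Gop R)) (Hop f).
Proof.
move=> q0; set Q := op_poly q (Gop R).
have hQ : lowers_degree Q := op_poly_lowers q0 (@Gop_lowers F R).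
pose D : {linear P -> P} := op_poly q^`() (Gop R) \o Gop R.
have GQ g : Gop R (Q g) = Q (Gop R g) by apply: op_poly_intertwine.
have DQ g : D (Q g) = Q (D g).
  by rewrite /= GQ; apply/esym/op_poly_intertwine => h.
have ad1 g : ad Q (@Hop F) 1 g = - D g by apply: commutator_Hop.
have ad2 k g : (2 <= k)%N -> ad Q (@Hop F) k g = 0.
  case: k => [|[|k]] // _; elim: k g => [|k IHk] g.
    rewrite -[LHS]/(commutator (ad Q (@Hop F) 1) Q g) /commutator !ad1 DQ.
    by rewrite /Q linearN subrr.
  rewrite -[LHS]/(commutator (ad Q (@Hop F) k.+2) Q g) /commutator !IHk.
  by rewrite /Q linear0 subrr.
have := op_exp_conj hQ (fun k => @ad2 k f).
rewrite !big_ord_recl big_ord0 addr0 !fact0 invr1 !scale1r ad1 => hH.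
have hD := op_exp_intertwine hQ hQ DQ f.
rewrite /Lop -mulNr -/(Hop _) hH -[op_poly _ _ _]/(D _) hD addrCA.
have [E opE] := op_exp_linear hQ.
by rewrite !opE linearN subrr addr0.
Qed.

Lemma Pq_eigenfunction R q n : q`_0 = 0 -> eigenfunction (Lop R q) (Pq R q n).
Proof.
move=> q0; have hQ := op_poly_lowers q0 (@Gop_lowers F R).
split; first by rewrite (op_exp_neq0 hQ (psi_neq0 n)).
exists n%:R; rewrite /Pq Lop_op_exp // Hop_psi.
have [E opE] := op_exp_linear hQ.
by rewrite !opE linearZ.
Qed.

Lemma Qn_op_exp R q n : q`_0 = 0 ->
  Qn R q n = op_exp (op_poly q (Ghat R)) (psi F n).
Proof.
move=> q0; have hQ := op_poly_lowers q0 (@Gop_lowers F R).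
have hQ' := op_poly_lowers q0 (@Ghat_lowers F R).
have GG f : fwd (Gop R f) = Ghat R (fwd f).
  by apply: op_poly_intertwine => g; apply: fwd_Hop.
have [E opE] := op_exp_linear hQ.
rewrite /Qn /Pq -linearZ opE -linearZ -opE /=.
rewrite (op_exp_intertwine hQ hQ' (op_poly_intertwine q GG)).
by rewrite linearZ /= fwd_psi scalerA mulVf ?scale1r // pnatr_eq0.
Qed.

End Operators.

Theorem theorem2p5 (K : realType) (R q : {poly K[i]})
    (hR : R != 0) (hq : q`_0 = 0) :
  [/\ forall n : nat, eigenfunction (Lop R q) (Pq R q n),
      exists gamma : nat -> nat -> K[i], forall n : nat,
        'X * Pq R q n = Pq R q n.+1
          + \sum_(j < (rec_order (deg R) (deg q)).+1 | (j <= n)%N)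
              gamma j n *: Pq R q (n - j)
    & forall n : nat, Qn R q n = op_exp (op_poly q (Ghat R)) (psi K[i] n)].
Proof.
split=> [n||n]; [exact: Pq_eigenfunction | exact: Pq_recurrence |].
exact: Qn_op_exp.
Qed.
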